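(* There is an absolute constant $K$ such that for every positive integer $m$, with $n=\binom{m}{2}$, $$\mathsf{rk}^{+}_{1/3}(M_{\mathsf{SINK}_n\circ\mathsf{XOR}})\le K m^4\quad\text{and}\quad \mathsf{rk}^{\mathrm{psd}}_{1/3}(M_{\mathsf{SINK}_n\circ\mathsf{XOR}})\le K m^{2.5}.$$
   Context: For $n=\binom{m}{2}$, $\mathsf{SINK}_n:\{0,1\}^n\to\{0,1\}$ views its input bits as orientations of the $n$ edges of the complete graph on $m$ vertices (each bit determines the direction of one edge, under a fixed convention), and outputs 1 if the resulting directed graph has a sink (a vertex all of whose incident edges are directed towards it), and 0 otherwise. $\mathsf{SINK}_n\circ\mathsf{XOR}:\{0,1\}^n\times\{0,1\}^n\to\{0,1\}$ is the function $(x,y)\mapsto\mathsf{SINK}_n(x\oplus y)$, where $\oplus$ is bitwise XOR. $M_F$ denotes the $2^n\times2^n$ matrix with $M_F(x,y)=F(x,y)$. For a real matrix $M$, $\mathsf{rk}^{+}_{\varepsilon}(M)$ is the minimum number of entrywise nonnegative rank-1 matrices whose sum $M'$ satisfies $|M'_{ij}-M_{ij}|\le\varepsilon$ for all $i,j$. For an entrywise nonnegative matrix $M$, its psd-rank is the minimal $d$ such that there exist $d\times d$ complex positive semidefinite matrices $A_i$ (one per row) and $B_j$ (one per column) with $M_{ij}=\mathrm{tr}(A_iB_j)$ for all $i,j$; $\mathsf{rk}^{\mathrm{psd}}_{\varepsilon}(M)$ is the minimum psd-rank among all entrywise nonnegative matrices $M'$ with $|M'_{ij}-M_{ij}|\le\varepsilon$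 for all $i,j$. *)

(* Defs.v *)
From mathcomp Require Import all_boot all_order all_algebra.
From mathcomp Require Import all_classical all_reals all_analysis.
From mathcomp Require Import sesquilinear spectral complex.

Set Implicit Arguments.
Unset Strict Implicit.
Unset Printing Implicit Defensive.

Import Order.TTheory GRing.Theory Num.Theory Num.Def.
Local Open Scope classical_set_scope.
Local Open Scope ring_scope.
Local Open Scope complex_scope.
Local Open Scope sesquilinear_scope.

(* The edge {i, j} with i < j of the complete graph on {0, ..., m-1} carries
   the bit number 'C(j, 2) + i: edges are listed by increasing larger endpoint,
   then by increasing smaller endpoint.  The next two lemmas show that this is
   a bijection from the edges onto {0, ..., 'C(m, 2) - 1}. *)
Definition edge_index (i j : nat) : nat := ('C(j, 2) + i)%N.

Lemma edge_index_lt (m i j : nat) :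
  (i < j)%N -> (j < m)%N -> (edge_index i j < 'C(m, 2))%N.
Proof.
move=> ij jm; apply: (@leq_trans 'C(j.+1, 2)); last exact: leq_bin2l.
by rewrite binS bin1 /edge_index ltn_add2l.
Qed.

Lemma edge_index_inj (i j i' j' : nat) : (i < j)%N -> (i' < j')%N ->
  edge_index i j = edge_index i' j' -> i = i' /\ j = j'.
Proof.
move=> ij ij' e.
have le a b c d : (a < b)%N -> edge_index a b = edge_index c d -> (d <= b)%N.
  move=> ab eq_; rewrite leqNgt; apply/negP => bd.
  have := edge_index_lt ab bd.
  by rewrite eq_ /edge_index ltnNge leq_addr.
have ejj : j = j'.
  by apply/eqP; rewrite eqn_leq (le _ _ _ _ ij' (esym e)) (le _ _ _ _ ij e).
by split=> //; move: e; rewrite ejj => /addnI.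
Qed.

(* For i < j, the bit of the edge {i, j} is 1 when the edge is directed from i
   to j, and 0 when it is directed from j to i.  (Only used for u != v.) *)
Definition arc (m : nat) (x : 'C(m, 2).-tuple bool) (u v : 'I_m) : bool :=
  if (u < v)%N then nth false x (edge_index u v)
  else ~~ nth false x (edge_index v u).

Definition is_sink (m : nat) (x : 'C(m, 2).-tuple bool) (v : 'I_m) : bool :=
  [forall u : 'I_m, (u != v) ==> arc x u v].

Definition SINK (m : nat) (x : 'C(m, 2).-tuple bool) : bool :=
  [exists v : 'I_m, is_sink x v].

Definition comp_XOR (n : nat) (f : n.-tuple bool -> bool)
    (x y : n.-tuple bool) : bool :=
  f [tuple tnth x k (+) tnth y k | k < n].

(* Rows and columns are numbered through the enumeration of {0,1}^n, whose
   cardinal is 2 ^ n. *)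
Definition comm_matrix (R : realType) (n : nat)
    (F : n.-tuple bool -> n.-tuple bool -> bool) :
    'M[R]_(#|{: n.-tuple bool}|, #|{: n.-tuple bool}|) :=
  \matrix_(i, j) (F (enum_val i) (enum_val j))%:R.

Definition nonneg_mx (R : realType) (p q : nat) (M : 'M[R]_(p, q)) : Prop :=
  forall i j, 0 <= M i j.

Definition approx_mx (R : realType) (p q : nat) (eps : R)
    (M M' : 'M[R]_(p, q)) : Prop :=
  forall i j, `|M' i j - M i j| <= eps.

(* Minimum of a set of natural numbers, as an extended real: it is attained
   when the set is nonempty, and is +oo when the set is empty. *)
Definition min_nat (R : realType) (S : set nat) : \bar R :=
  ereal_inf [set (r%:R)%:E | r in S].

Definition nonneg_rank_approx (R : realType) (p q : nat) (eps : R)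
    (M : 'M[R]_(p, q)) : \bar R :=
  min_nat R [set r | exists N : 'I_r -> 'M[R]_(p, q),
    (forall k, nonneg_mx (N k) /\ \rank (N k) = 1%N) /\
    approx_mx eps M (\sum_k N k)].

Definition psd_mx (R : realType) (d : nat) (A : 'M[R[i]]_d) : Prop :=
  A \is hermsymmx /\ forall v : 'cV[R[i]]_d, 0 <= (v ^t* *m A *m v) 0 0.

Definition psd_rank (R : realType) (p q : nat) (M : 'M[R]_(p, q)) : \bar R :=
  min_nat R [set d | exists (A : 'I_p -> 'M[R[i]]_d) (B : 'I_q -> 'M[R[i]]_d),
    [/\ forall i, psd_mx (A i), forall j, psd_mx (B j) &
        forall i j, (M i j)%:C = \tr (A i *m B j)]].

Definition psd_rank_approx (R : realType) (p q : nat) (eps : R)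
    (M : 'M[R]_(p, q)) : \bar R :=
  ereal_inf [set psd_rank M' | M' in
    [set M' : 'M[R]_(p, q) | nonneg_mx M' /\ approx_mx eps M M']].

(* Main.v *)
Require Import Defs.
From mathcomp Require Import all_boot all_order all_algebra.
From mathcomp Require Import all_classical all_reals all_analysis.
From mathcomp Require Import sesquilinear complex.
From mathcomp Require Import ring lra zify.

Set Implicit Arguments.
Unset Strict Implicit.
Unset Printing Implicit Defensive.

Import Order.TTheory GRing.Theory Num.Theory.
Local Open Scope ring_scope.

(** Sinks are unique, and [v] is a sink of [x (+) y] iff a key of [x] at [v]
    equals a key of [y] at [v], each key being a string of [m] bits.  So the
    matrix is a sum of [m] equality matrices on [2 ^ m] keys, and it suffices
    to approximate equality with error [1 / (3 m)].

    For the nonnegative rank, encode the keys by codewords of length [12 m^2]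
    over [18 m] letters, any two of which agree in at most [4 m] positions, and
    average over the positions the events that the two letters coincide: this
    costs [O(m^3)] rectangles per vertex.

    For the psd rank, pure states would need dimension of order [m^2].  Instead
    encode a key by the (almost) projector [V V^T / d], where [V] is a [d * r]
    matrix of signs, [r] is of order [sqrt m] and [d] of order [m r].  The trace
    of a product of two of these is a sum of [r^2 >= m] squared inner products
    of columns, so that it concentrates around its mean strongly enough for a
    union bound over the keys, although [d] is only of order [m^1.5].

    Both families are chosen greedily; the concentration bounds are exponential
    moment computations over uniformly random letters or signs. *)

(** * Greedy selection and exponential moments *)

Lemma card_has_le (T : finType) (bad : rel T) (B : nat) (s : seq T) :
  {in s, forall x, #|bad x| <= B}%N ->
  (#|[pred y | has (bad^~ y) s]| <= size s * B)%N.
Proof.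
elim: s => [|x s IH] hB; first by rewrite mul0n eq_card0.
rewrite /= mulSn.
apply: (@leq_trans (#|bad x| + #|[pred y | has (bad^~ y) s]|)).
  rewrite -(cardUI (bad x) [pred y | has (bad^~ y) s]).
  apply: leq_trans (leq_addr _ _).
  by rewrite leq_eqVlt; apply/orP; left; apply/eqP/eq_card => y; rewrite !inE.
apply: leq_add; first by apply: hB; rewrite mem_head.
by apply: IH => y ys; apply: hB; rewrite in_cons ys orbT.
Qed.

(** Each element already chosen excludes at most [B] candidates, so fewer than [n] choices cannot
    exhaust the good elements. *)
Lemma greedy_seq (T : finType) (good : pred T) (bad : rel T) (B n : nat) :
  (forall x, good x -> #|bad x| <= B)%N -> (B * n < #|good|)%N ->
  exists s : seq T,
    [/\ size s = n, all good s & pairwise (fun x y => ~~ bad x y) s].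
Proof.
move=> hB; elim: n => [|n IH] hn; first by exists [::].
have [s [sz sg sp]] := IH (leq_ltn_trans (leq_mul (leqnn B) (leqnSn n)) hn).
have [y /andP[gy ny]] : exists y, good y && ~~ has (bad^~ y) s.
  apply/existsP; apply: contraLR hn => /existsPn h.
  rewrite -leqNgt mulnC.
  apply: (@leq_trans #|[pred y | has (bad^~ y) s]|).
    apply/subset_leq_card/fintype.subsetP => y gy; rewrite inE.
    by have := h y; rewrite -[good y]/(y \in good) gy /= negbK.
  apply: leq_trans (card_has_le _) _.
    by move=> x xs; apply: hB; apply: (allP sg).
  by rewrite sz leq_mul2r leqnSn orbT.
exists (rcons s y); rewrite size_rcons sz all_rcons gy pairwise_rcons sp andbT.
by split=> //; apply/allP => x xs; apply: contra ny => bxy; apply/hasP; exists x.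
Qed.

Lemma greedy_family (T K : finType) (good : pred T) (bad : rel T) (B : nat) :
  symmetric bad -> (forall x, good x -> #|bad x| <= B)%N ->
  (B * #|K| < #|good|)%N ->
  exists f : K -> T, (forall k, good (f k)) /\
    (forall k k', k != k' -> ~~ bad (f k) (f k')).
Proof.
move=> sb hB hn; have [s [sz /allP sg sp]] := greedy_seq hB hn.
have /card_gt0P[x0 _] : (0 < #|good|)%N by apply: leq_ltn_trans hn.
exists (fun k => nth x0 s (enum_rank k)); split=> [k|k k' kk'].
  by apply: sg; rewrite mem_nth // sz.
have lt (a b : K) : (enum_rank a < enum_rank b)%N ->
    ~~ bad (nth x0 s (enum_rank a)) (nth x0 s (enum_rank b)).
  by move=> ab; apply: (pairwiseP x0 sp) ab; rewrite inE sz; apply: ltn_ord.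
case: (ltngtP (enum_rank k) (enum_rank k')) => [|kk1|e]; first exact: lt.
  by rewrite sb; apply: lt.
by move: kk'; rewrite (enum_rank_inj (val_inj e)) eqxx.
Qed.

Section Exponential.
Variable R : realType.
Implicit Types (x t : R).

(** Chernoff's method in counting form: each [w] with [b < g w] contributes at least [expR b] to the
    sum. *)
Lemma markov_expR (T : finType) (g : T -> R) (a b : R) :
  \sum_w expR (g w) <= #|T|%:R * expR a ->
  #|[pred w | b < g w]|%:R <= #|T|%:R * expR (a - b).
Proof.
move=> h; rewrite expRD expRN mulrA ler_pdivlMr ?expR_gt0 //.
apply: le_trans h; rewrite -sum1_card natr_sum mulr_suml.
rewrite [leRHS](bigID [pred w | b < g w]) /= -[leLHS]addr0 lerD //.
  by apply: ler_sum => w; rewrite inE mul1r ler_expR => /ltW.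
by apply: sumr_ge0 => w _; rewrite expR_ge0.
Qed.

Lemma expR_le_inv1B x : x < 1 -> expR x <= (1 - x)^-1.
Proof.
move=> x1; rewrite -[x in expR x]opprK expRN lef_pV2 ?posrE ?expR_gt0 ?subr_gt0 //.
exact: expR_ge1Dx.
Qed.

Lemma expRD_expRN_le x : expR x + expR (- x) <= 2 * expR (2 * x ^+ 2).
Proof.
(* If [1/2 <= |x|], then [|x| <= 2 x^2] and each term is bounded separately. Otherwise both terms
   are bounded by the inverses of [1 - x] and [1 + x], whose sum is [2 / (1 - x^2)]. *)
have [x2|x2] := leP 1 (4 * x ^+ 2).
  rewrite mulr2n mulrDl !mul1r lerD // ler_expR.
    by nra.
  by nra.
have x1 : -(1/2) < x < 1/2 by apply/andP; split; nra.
apply: (@le_trans _ _ ((1 - x)^-1 + (1 + x)^-1)).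
  apply: lerD; first by apply: expR_le_inv1B; lra.
  by rewrite -{2}[x]opprK; apply: expR_le_inv1B; lra.
apply: (@le_trans _ _ (2 * (1 + 2 * x ^+ 2))); last first.
  by rewrite ler_pM2l ?ltr0n // expR_ge1Dx.
have -> : (1 - x)^-1 + (1 + x)^-1 = 2 / (1 - x ^+ 2).
  by field; rewrite !lt0r_neq0 //; nra.
rewrite ler_pdivrMr; last by nra.
have := sqr_ge0 x; nra.
Qed.

(** Independence of the signs factors the sum into one hyperbolic cosine per index: a sub-Gaussian
    bound, with constant 2 in place of the optimal 1/2. *)
Lemma sum_sign_expR (I : finType) (a : I -> R) :
  \sum_(w : {ffun I -> bool}) expR (\sum_i a i * (-1) ^+ w i)
  <= #|{ffun I -> bool}|%:R * expR (2 * \sum_i a i ^+ 2).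
Proof.
under eq_bigr do rewrite expR_sum.
rewrite -(bigA_distr_bigA (fun i (b : bool) => expR (a i * (-1) ^+ b))).
rewrite card_ffun card_bool natrX -[X in _ <= X * _]prodr_const mulr_sumr expR_sum.
rewrite -big_split /=; apply: ler_prod => i _; rewrite big_bool /=.
rewrite addr_ge0 ?expR_ge0 //= expr1 expr0 mulrN1 mulr1 addrC.
exact: expRD_expRN_le.
Qed.

(** A finite index type for the integers from [-n] to [n], zero being counted twice; finiteness lets
    a product of such sums be expanded over functions. *)
Definition signed_nat (n : nat) (j : bool * 'I_n.+1) : R := (-1) ^+ j.1 * j.2%:R.

(* A discrete substitute for the Gaussian identity E exp(g t) = exp(t^2/2):
   rounding t/2 towards zero gives an integer j with j t - j^2 >= t^2/4 - 1. *)
Lemma expR_sqr_le_sum (n : nat) t : `|t| <= n%:R ->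
  expR (t ^+ 2 / 4)
  <= \sum_(j : bool * 'I_n.+1) expR (1 + signed_nat j * t - signed_nat j ^+ 2).
Proof.
move=> tn; have t0 : 0 <= `|t| / 2 by rewrite divr_ge0.
have /andP[l1 l2] := Num.Theory.truncn_itv t0.
set k := Num.trunc _ in l1 l2.
have kn : (k < n.+1)%N.
  by rewrite -(ltr_nat R) -[n.+1]addn1 natrD; lra.
pose j := (t < 0, Ordinal kn) : bool * 'I_n.+1.
rewrite (bigD1 j) //=.
apply: (@le_trans _ _ (expR (1 + signed_nat j * t - signed_nat j ^+ 2))); last first.
  by rewrite lerDl sumr_ge0 // => i _; rewrite expR_ge0.
rewrite ler_expR /signed_nat /= exprMn sqrr_sign mul1r.
have -> : (-1) ^+ (t < 0)%R * k%:R * t = k%:R * `|t| by rewrite normrEsign mulrCA mulrA.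
rewrite -(real_normK (num_real t)).
rewrite -[k.+1]addn1 natrD in l2.
have : 0 <= (`|t| / 2 - k%:R) * (1 - (`|t| / 2 - k%:R)) by apply: mulr_ge0; lra.
nra.
Qed.

(** Since [n <= n^2] and [3/2 <= expR (1/2)], the Gaussian tail is dominated by a geometric one,
    which has an explicit sum. *)
Lemma expR_half_sqr_le (n : nat) : expR (- (n%:R ^+ 2 / 2)) <= (2 / 3 : R) ^+ n.
Proof.
have -> : (2 / 3 : R) = (1 + 1 / 2)^-1 by field.
have p : 0 < 1 + 1 / 2 :> R by lra.
rewrite exprVn expRN lef_pV2 ?posrE ?expR_gt0 ?exprn_gt0 //.
apply: (@le_trans _ _ (expR (1 / 2) ^+ n)).
  by rewrite lerXn2r ?nnegrE ?expR_ge0 ?expR_ge1Dx //; lra.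
rewrite -expRM_natl ler_expR mulrA ler_pM2r ?invr_gt0 ?ltr0n // mulr1.
by rewrite -natrX ler_nat; case: n => // n; rewrite expnS leq_pmulr.
Qed.

Lemma sum_expR_signed_nat (n : nat) :
  \sum_(j : bool * 'I_n.+1) expR (1 - signed_nat j ^+ 2 / 2) <= expR 4.
Proof.
rewrite -(pair_bigA _ (fun b k => expR (1 - signed_nat (b, k) ^+ 2 / 2))) /=.
rewrite big_bool.
have geo : \sum_(k < n.+1) (2 / 3 : R) ^+ k <= 3.
  suff -> : \sum_(k < n.+1) (2 / 3 : R) ^+ k = 3 - 3 * (2 / 3) ^+ n.+1.
    by rewrite gerDl oppr_le0 mulr_ge0 ?exprn_ge0 //; lra.
  elim: n.+1 => [|k IH]; first by rewrite big_ord0; lra.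
  by rewrite big_ord_recr /= IH exprS; lra.
have sum3 (b : bool) :
    \sum_(k < n.+1) expR (1 - signed_nat (b, k) ^+ 2 / 2) <= expR 1 * 3 :> R.
  apply: le_trans (ler_wpM2l (expR_ge0 _) geo).
  rewrite mulr_sumr; apply: ler_sum => k _.
  by rewrite expRD ler_pM2l ?expR_gt0 // exprMn sqrr_sign mul1r expR_half_sqr_le.
(* The two signs give [6 * expR 1] in total, and [6 <= 2^3 <= expR 3]. *)
apply: le_trans (lerD (sum3 true) (sum3 false)) _.
have -> : (4 : R) = 1 + 3%:R * 1 by lra.
rewrite expRD expRM_natl -mulrDr ler_pM2l ?expR_gt0 //.
have e2 : 2 <= expR 1 :> R by apply: le_trans (expR_ge1Dx _); lra.
by apply: (@le_trans _ _ (2 ^+ 3)); [lra | rewrite lerXn2r ?nnegrE //; lra].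
Qed.
End Exponential.

(** * Codes *)

Section Families.
Variable R : realType.

Lemma expR1_gt2 : 2 < expR 1 :> R.
Proof. by have := @expR_gt1Dx R 1 (oner_neq0 _); lra. Qed.

Lemma expR1_le4 : expR 1 <= 4 :> R.
Proof.
have h : expR (1 / 2) <= 2 :> R.
  apply: le_trans (expR_le_inv1B _) _; first by lra.
  by rewrite -[leRHS]invrK lef_pV2 ?posrE; lra.
have -> : (1 : R) = 1 / 2 + 1 / 2 by field.
by rewrite expRD; have := expR_ge0 (1 / 2 : R); nra.
Qed.

(** The union bound over [2 ^ m] keys with failure probability [expR (- 2 m)]; the extra factor 2
    allows for only half of the candidates being good. *)
Lemma pow2_expRN_lt (m : nat) : (0 < m)%N ->
  2 * (2 ^ m)%:R * expR (- (2 * m%:R)) < 1 :> R.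
Proof.
move=> m0; rewrite expRN ltr_pdivrMr ?expR_gt0 // mul1r.
have e : (2 ^ m)%:R < expR m%:R :> R.
  rewrite -[m%:R]mulr1 expRM_natl natrX ltrXn2r ?nnegrE ?expR1_gt2 ?expR_ge0 -?lt0n //.
have t : 2 <= (2 ^ m)%:R :> R.
  rewrite (ler_nat _ 2); case: m m0 {e} => // m _.
  by rewrite expnS leq_pmulr // expn_gt0.
have -> : 2 * m%:R = m%:R + m%:R :> R by ring.
by rewrite expRD; nra.
Qed.

Definition agreement (I J : finType) (c c' : {ffun I -> J}) : nat :=
  #|[pred i | c i == c' i]|.

Lemma natr_agreement (I J : finType) (c c' : {ffun I -> J}) :
  (agreement c c')%:R = \sum_i (c i == c' i)%:R :> R.
Proof.
rewrite /agreement -sum1_card natr_sum big_mkcond.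
by apply: eq_bigr => i _; rewrite inE; case: eqP.
Qed.

(** The positions of a random [c'] are independent and each agrees with probability [1 / #|J|], so
    each contributes a factor at most [1 + 3 / #|J|], using [expR 1 <= 4]. *)
Lemma sum_expR_agreement (I J : finType) (c : {ffun I -> J}) : (0 < #|J|)%N ->
  \sum_c' expR (agreement c c')%:R
  <= #|{ffun I -> J}|%:R * expR (3 * #|I|%:R / #|J|%:R) :> R.
Proof.
move=> J0; have J0R : 0 < #|J|%:R :> R by rewrite ltr0n.
under eq_bigr do rewrite natr_agreement expR_sum.
rewrite -(bigA_distr_bigA (fun i a => expR (c i == a)%:R)).
rewrite [3 * _]mulrC -mulrA expRM_natl card_ffun natrX -exprMn.
rewrite -[X in _ <= X]prodr_const; apply: ler_prod => i _.
rewrite sumr_ge0 => [|a _]; last exact: expR_ge0.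
apply: (@le_trans _ _ (#|J|%:R * (1 + 3 / #|J|%:R))); last first.
  by rewrite [3 / _]mulrC ler_pM2l // expR_ge1Dx.
have -> : #|J|%:R * (1 + 3 / #|J|%:R) = \sum_(a : J) (1 + 3 * (c i == a)%:R) :> R.
  rewrite big_split sumr_const /= -mulr_sumr -natr_sum (bigD1 (c i)) //= eqxx.
  rewrite big1 => [|a /negPf]; last by rewrite eq_sym => ->.
  by rewrite addn0 (eq_card (_ : xpredT =i J)) // mulr1; field; rewrite lt0r_neq0.
apply: ler_sum => a _; case: eqP => _; rewrite ?expR0 ?mulr0 ?addr0 //.
by rewrite mulr1; have := expR1_le4; lra.
Qed.

Lemma greedy_random (T K : finType) (good : pred T) (bad : rel T) (e : R) :
  symmetric bad -> (forall x, good x -> #|bad x|%:R <= e) -> 0 <= e ->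
  e * #|K|%:R < #|good|%:R ->
  exists f : K -> T, (forall k, good (f k)) /\
    (forall k k', k != k' -> ~~ bad (f k) (f k')).
Proof.
move=> sb hB e0 hn; apply: (@greedy_family _ _ good bad (Num.trunc e)) => //.
  by move=> x gx; rewrite truncn_ge_nat // hB.
rewrite -(ltr_nat R) natrM; apply: le_lt_trans hn.
by rewrite ler_wpM2r // truncn_le.
Qed.

(** The lengths make the moment exponent [3 * 12 m^2 / (18 m) = 2 m]. Exceeding [4 m] agreements
    then has probability at most [expR (- 2 m)], and [4 m] is the fraction [1 / (3 m)] of the
    positions. *)
Lemma code_exists (m : nat) : (0 < m)%N ->
  exists c : {ffun 'I_m -> bool} -> {ffun 'I_(12 * m ^ 2) -> 'I_(18 * m)},
  forall k k', k != k' -> (agreement (c k) (c k') <= 4 * m)%N.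
Proof.
move=> m0; have mR : 0 < m%:R :> R by rewrite ltr0n.
set I := 'I_(12 * m ^ 2); set J := 'I_(18 * m).
have J0 : (0 < #|J|)%N by rewrite card_ord muln_gt0.
pose bad : rel {ffun I -> J} := fun c c' => (4 * m < agreement c c')%N.
have [|c _|||c [_ hc]] := @greedy_random {ffun I -> J} {ffun 'I_m -> bool} predT bad
   (#|{ffun I -> J}|%:R * expR (2 * m%:R - 4 * m%:R)).
- move=> c c'; rewrite /bad /agreement.
  by congr (_ < _)%N; apply: eq_card => i; rewrite !inE eq_sym.
- apply: le_trans (@markov_expR R _ (fun c' => (agreement c c')%:R) _ (4 * m%:R) _).
    rewrite ler_nat; apply: subset_leq_card; apply/fintype.subsetP => c'.
    by rewrite !inE /bad -natrM ltr_nat.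
  apply: le_trans (sum_expR_agreement c J0) _.
  rewrite ler_pM2l ?ltr0n ?card_ffun ?expn_gt0 ?J0 // ler_expR !card_ord.
  rewrite !natrM le_eqVlt; apply/orP; left; apply/eqP.
  by field; rewrite lt0r_neq0.
- by rewrite mulr_ge0 ?expR_ge0.
- have -> : 2 * m%:R - 4 * m%:R = - (2 * m%:R) :> R by ring.
  have -> : #|{ffun 'I_m -> bool}| = (2 ^ m)%N by rewrite card_ffun card_bool card_ord.
  rewrite -mulrA.
  rewrite -[ltRHS]mulr1.
  rewrite ltr_pM2l ?ltr0n ?card_ffun ?expn_gt0 ?J0 //.
  have := pow2_expRN_lt m0; rewrite -mulrA [X in 2 * X]mulrC.
  suff : 0 <= expR (- (2 * m%:R)) * (2 ^ m)%:R :> R by lra.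
  by rewrite mulr_ge0 ?expR_ge0.
by exists c => k k' /hc; rewrite /bad -leqNgt.
Qed.

End Families.

(** * Random sign matrices *)

Section SignMatrices.
Variables (R : realType) (D C : finType).
Notation signs := {ffun D * C -> bool}.
Implicit Types (V W : signs) (k l : C).

Definition entry V (i : D) k : R := (-1) ^+ V (i, k).

Definition col_dot V k W l : R := \sum_i entry V i k * entry W i l.

(** The squared Frobenius norm of [V^T W], which is the trace of [V V^T W W^T]. *)
Definition overlap V W : R := \sum_k \sum_l col_dot V k W l ^+ 2.

(** The squared Frobenius norm of the off-diagonal part of the Gram matrix [V^T V]. *)
Definition defect V : R := \sum_k \sum_(l | l != k) col_dot V k V l ^+ 2.

Lemma entry_sqr V i k : entry V i k ^+ 2 = 1.
Proof. by rewrite sqrr_sign. Qed.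

Lemma col_dotC V k W l : col_dot V k W l = col_dot W l V k.
Proof. by apply: eq_bigr => i _; rewrite mulrC. Qed.

Lemma overlap_ge0 V W : 0 <= overlap V W.
Proof. by do 2!(apply: sumr_ge0 => ? _); rewrite sqr_ge0. Qed.

Lemma overlapC V W : overlap V W = overlap W V.
Proof.
rewrite /overlap exchange_big; apply: eq_bigr => l _.
by apply: eq_bigr => k _; rewrite col_dotC.
Qed.

Lemma col_dot_diag V k : col_dot V k V k = #|D|%:R.
Proof.
rewrite /col_dot (eq_bigr (fun=> 1)) => [|i _]; first by rewrite sumr_const.
by rewrite -expr2 entry_sqr.
Qed.

Lemma col_dot_le V k W l : `|col_dot V k W l| <= #|D|%:R.
Proof.
apply: le_trans (ler_norm_sum _ _ _) _.
rewrite (eq_bigr (fun=> 1)) => [|i _]; first by rewrite sumr_const.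
by rewrite normrM !normr_sign mulr1.
Qed.

Lemma overlap_diag V : overlap V V = #|C|%:R * #|D|%:R ^+ 2 + defect V.
Proof.
rewrite /overlap (eq_bigr (fun k => #|D|%:R ^+ 2
    + \sum_(l | l != k) col_dot V k V l ^+ 2)) => [|k _].
  by rewrite big_split sumr_const mulr_natl.
by rewrite (bigD1 k) //= col_dot_diag.
Qed.

Lemma defect_ge0 V : 0 <= defect V.
Proof. by do 2!(apply: sumr_ge0 => ? _); rewrite sqr_ge0. Qed.

Lemma sum_sqr_col_dot k l : l != k ->
  \sum_V col_dot V k V l ^+ 2 = #|{: signs}|%:R * #|D|%:R.
Proof.
move=> lk.
pose F i i' V := entry V i k * entry V i l * (entry V i' k * entry V i' l).
have -> : \sum_V col_dot V k V l ^+ 2 = \sum_i \sum_i' \sum_V F i i' V.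
  under [RHS]eq_bigr do rewrite exchange_big.
  rewrite [RHS]exchange_big; apply: eq_bigr => V _.
  by rewrite expr2 mulr_suml; apply: eq_bigr => i _; rewrite mulr_sumr.
rewrite (eq_bigr (fun=> #|{: signs}|%:R)) => [|i _].
  by rewrite sumr_const mulr_natr.
rewrite (bigD1 i) //= [X in _ + X]big1 ?addr0 => [|i' i'i].
  rewrite (eq_bigr (fun=> 1)) => [|V _]; first by rewrite sumr_const.
  by rewrite /F -expr2 exprMn !entry_sqr mulr1.
(* For distinct rows, flipping the single sign at [(i, k)] permutes the sign matrices and negates
   [F i i'], so the cross terms cancel. *)
pose flip V : signs := [ffun p => V p (+) (p == (i, k))].
have flipK : involutive flip.
  by move=> V; apply/ffunP => p; rewrite !ffunE addbK.
have : \sum_V F i i' V = - \sum_V F i i' V.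
  rewrite {1}(reindex_inj (inv_inj flipK)) -sumrN; apply: eq_bigr => V _.
  rewrite /F /entry !ffunE !xpair_eqE !eqxx (negPf lk) (negPf i'i) /= !addbF.
  by rewrite addbT signrN !mulNr.
by move=> h; lra.
Qed.

Lemma sum_defect_le :
  \sum_V defect V <= #|{: signs}|%:R * (#|C|%:R ^+ 2 * #|D|%:R).
Proof.
rewrite /defect exchange_big /=.
apply: (@le_trans _ _ (\sum_(k : C) \sum_(l : C) #|{: signs}|%:R * #|D|%:R)).
  apply: ler_sum => k _; rewrite exchange_big /= big_mkcond.
  apply: ler_sum => l _; case: ifP => [lk|_]; first by rewrite sum_sqr_col_dot.
  by rewrite mulr_ge0.
rewrite !sumr_const -mulrnA -[leLHS]mulr_natr natrM le_eqVlt.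
by apply/orP; left; apply/eqP; ring.
Qed.

(** Markov's inequality, the threshold being twice the bound on the mean in [sum_defect_le]. *)
Lemma card_small_defect : (0 < #|C|)%N -> (0 < #|D|)%N ->
  #|{: signs}|%:R / 2
  <= #|[pred V | defect V <= 2 * #|C|%:R ^+ 2 * #|D|%:R]|%:R :> R.
Proof.
move=> C0 D0; set b := 2 * _ * _.
have b0 : 0 < b by rewrite !mulr_gt0 ?exprn_gt0 ?ltr0n.
have := cardC [pred V | defect V <= b].
set g := #|_|; set h := #|_| => e.
have hb : h%:R * b <= #|{: signs}|%:R * b / 2.
  apply: (@le_trans _ _ (\sum_V defect V)); last first.
    by apply: le_trans sum_defect_le _; rewrite /b; lra.
  rewrite /h -sum1_card natr_sum mulr_suml big_mkcond.
  apply: ler_sum => V _; case: ifP => [|_]; last exact: defect_ge0.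
  by rewrite !inE -ltNge mul1r => /ltW.
have {}hb : h%:R <= #|{: signs}|%:R / 2 :> R.
  by rewrite -(ler_pM2r b0); apply: le_trans hb _; lra.
by rewrite -e natrD in hb *; lra.
Qed.

(* A small defect makes the Gram matrix of the columns close to |D| times
   the identity, by Cauchy-Schwarz in its additive form
   2 D J a b <= (J a)^2 + (D b)^2. *)
Lemma sum_sqr_comb_le V (j : C -> R) : defect V <= #|D|%:R ^+ 2 ->
  \sum_i (\sum_k j k * entry V i k) ^+ 2 <= 2 * #|D|%:R * \sum_k j k ^+ 2.
Proof.
move=> hV; set J := \sum_k j k ^+ 2; set d : R := #|D|%:R in hV *.
have J0 : 0 <= J by apply: sumr_ge0 => k _; rewrite sqr_ge0.
pose X := \sum_k \sum_(l | l != k) j k * j l * col_dot V k V l.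
have -> : \sum_i (\sum_k j k * entry V i k) ^+ 2 = d * J + X.
  transitivity (\sum_k \sum_l j k * j l * col_dot V k V l).
    transitivity (\sum_i \sum_k \sum_l j k * j l * (entry V i k * entry V i l)).
      apply: eq_bigr => i _; rewrite expr2 mulr_suml; apply: eq_bigr => k _.
      by rewrite mulr_sumr; apply: eq_bigr => l _; ring.
    rewrite exchange_big; apply: eq_bigr => k _; rewrite exchange_big.
    by apply: eq_bigr => l _; rewrite -mulr_sumr.
  rewrite /J mulr_sumr -big_split; apply: eq_bigr => k _ /=.
  by rewrite (bigD1 k) //= col_dot_diag; ring.
have d0 : 0 <= d by rewrite /d ler0n.
have hX : 2 * d * J * X <= 2 * (d * J) ^+ 2.
  apply: (@le_trans _ _ (J ^+ 2 * defect V + (d * J) ^+ 2)); last first.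
    by have := ler_wpM2l (sqr_ge0 J) hV; rewrite exprMn; lra.
  have -> : (d * J) ^+ 2 = d ^+ 2 * \sum_k \sum_l (j k * j l) ^+ 2.
    rewrite exprMn [J ^+ 2]expr2 {1}/J mulr_suml; congr (_ * _).
    apply: eq_bigr => k _; rewrite /J mulr_sumr; apply: eq_bigr => l _.
    by rewrite exprMn.
  clearbody J; rewrite /X /defect !mulr_sumr -big_split; apply: ler_sum => k _ /=.
  rewrite !mulr_sumr [X in _ + X](bigID (fun l => l != k)) /= addrA -big_split /=.
  rewrite -[leLHS]addr0 lerD //; last first.
    by apply: sumr_ge0 => l _; rewrite mulr_ge0 ?sqr_ge0.
  apply: ler_sum => l _.
  have := sqr_ge0 (J * col_dot V k V l - d * (j k * j l)); lra.
(* Dividing [hX] by [d * J] needs it to be positive; otherwise there are no rows or all coefficients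
   vanish, and [X = 0]. *)
have [dJ|dJ] := ltP 0 (d * J).
  have : (d * J) * X <= (d * J) * (d * J) by lra.
  by rewrite ler_pM2l //; lra.
have {}dJ : d * J = 0 by apply/eqP; rewrite eq_le dJ mulr_ge0.
move/eqP: dJ; rewrite mulf_eq0 => /orP[/eqP z|/eqP z].
  have e0 : D -> False.
    by move: z => /eqP; rewrite pnatr_eq0 => /eqP/card0_eq z i; have := z i; rewrite inE.
  have -> : X = 0.
    rewrite /X big1 // => k _; rewrite big1 // => l _.
    by rewrite /col_dot big1 ?mulr0 // => i; case: (e0 i).
  by rewrite z !(mul0r, mulr0) addr0.
have jz k : j k = 0.
  apply/eqP; rewrite -sqrf_eq0; apply/eqP; apply: (psumr_eq0P _ z) => // l _.
  exact: sqr_ge0.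
have -> : X = 0.
  by rewrite /X big1 // => k _; rewrite big1 // => l _; rewrite jz !mul0r.
by rewrite z !mulr0 addr0.
Qed.

(** Linearize each squared inner product by [expR_sqr_le_sum], so that the average over [W] becomes
    a sub-Gaussian moment of a linear form. Its variance is controlled by [sum_sqr_comb_le], and
    each of the [#|C|^2] pairs finally costs a factor [expR 4]. *)
Lemma sum_expR_overlap V : defect V <= #|D|%:R ^+ 2 -> (0 < #|D|)%N ->
  \sum_W expR (overlap V W / (32 * #|D|%:R))
  <= #|{: signs}|%:R * expR (4 * #|C|%:R ^+ 2).
Proof.
move=> hV D0; have d1 : 1 <= #|D|%:R :> R by rewrite ler1n.
set d : R := #|D|%:R in hV d1 *.
(* With this scale, [t^2 / 4] is the squared inner product over [32 d]. Also [2 * s^2 * 2 d = 1/2],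
   so the sub-Gaussian growth uses up only half of the damping [- z^2]. *)
pose s := Num.sqrt (8 * d)^-1.
have s2 : s ^+ 2 = (8 * d)^-1 by rewrite sqr_sqrtr // invr_ge0; lra.
(* The bound [s <= 1] keeps [|t|] below [#|D|], the range of the integers in [Z]. *)
have s01 : 0 <= s <= 1.
  rewrite sqrtr_ge0 -sqrtr1 ler_wsqrtr // -[leRHS]invr1.
  by rewrite lef_pV2 ?posrE; lra.
pose Z := (bool * 'I_#|D|.+1)%type.
pose t W (p : C * C) := s * col_dot V p.1 W p.2.
have tle W p : `|t W p| <= #|D|%:R.
  rewrite normrM ger0_norm; last by case/andP: s01.
  have [s0 s1] := andP s01.
  by apply: le_trans (ler_pM _ _ s1 (col_dot_le _ _ _ _)) _; rewrite ?mul1r.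
pose z (f : {ffun C * C -> Z}) p : R := signed_nat R (f p).
have step W : expR (overlap V W / (32 * d)) <= \sum_(f : {ffun C * C -> Z})
    expR (\sum_p (1 - z f p ^+ 2)) * expR (\sum_p z f p * t W p).
  have -> : overlap V W / (32 * d) = \sum_p t W p ^+ 2 / 4.
    rewrite /overlap pair_bigA mulr_suml; apply: eq_bigr => p _.
    rewrite /t exprMn s2 /=; field; lra.
  rewrite expR_sum.
  apply: (@le_trans _ _ (\prod_p \sum_(j : Z)
      expR (1 + signed_nat R j * t W p - signed_nat R j ^+ 2))).
    by apply: ler_prod => p _; rewrite expR_ge0 expR_sqr_le_sum.
  rewrite bigA_distr_bigA /= le_eqVlt; apply/orP; left; apply/eqP.
  apply: eq_bigr => f _; rewrite -expR_sum -expRD -big_split /=.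
  by congr expR; apply: eq_bigr => p _; rewrite /z; ring.
apply: le_trans (ler_sum _ (fun W _ => step W)) _.
rewrite exchange_big /=.
have inner (f : {ffun C * C -> Z}) : \sum_W expR (\sum_p z f p * t W p)
    <= #|{: signs}|%:R * expR (\sum_p z f p ^+ 2 / 2).
  (* For fixed [f], these are the coefficients of the exponent as a linear form in the signs of
     [W]. *)
  pose a (q : D * C) := s * \sum_k z f (k, q.2) * entry V q.1 k.
  rewrite (eq_bigr (fun W : signs => expR (\sum_q a q * (-1) ^+ W q))) => [|W _].
    apply: le_trans (sum_sign_expR a) _; rewrite ler_wpM2l // ler_expR.
    have -> : \sum_q a q ^+ 2
        = s ^+ 2 * \sum_l \sum_i (\sum_k z f (k, l) * entry V i k) ^+ 2.
      rewrite exchange_big pair_bigA mulr_sumr; apply: eq_bigr => q _.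
      by rewrite /a exprMn.
    have -> : \sum_p z f p ^+ 2 / 2
        = 2 * (s ^+ 2 * \sum_l 2 * d * \sum_k z f (k, l) ^+ 2).
      rewrite -mulr_sumr exchange_big pair_bigA -mulr_suml s2 /=.
      under [X in _ = _ * (_ * (_ * X))]eq_bigr do rewrite -surjective_pairing.
      by field; lra.
    rewrite ler_pM2l // ler_wpM2l ?sqr_ge0 //; apply: ler_sum => l _.
    exact: sum_sqr_comb_le.
  congr expR; transitivity (\sum_k \sum_l \sum_i
      z f (k, l) * (s * (entry V i k * entry W i l))).
    rewrite pair_bigA; apply: eq_bigr => -[k l] _.
    by rewrite /t /col_dot /= 2!mulr_sumr.
  rewrite exchange_big [RHS](eq_bigr (fun q => \sum_k
     z f (k, q.2) * (s * (entry V q.1 k * entry W q.1 q.2)))) => [|[i l] _].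
    rewrite -(pair_bigA _ (fun i l => \sum_k
      z f (k, l) * (s * (entry V i k * entry W i l)))) /= [RHS]exchange_big.
    by apply: eq_bigr => l _; rewrite exchange_big.
  rewrite /a mulr_sumr mulr_suml /=; apply: eq_bigr => k _.
  by rewrite -[(-1) ^+ W (i, l)]/(entry W i l); ring.
apply: (@le_trans _ _ (\sum_(f : {ffun C * C -> Z})
    #|{: signs}|%:R * expR (\sum_p (1 - z f p ^+ 2 / 2)))).
  apply: ler_sum => f _; rewrite -mulr_sumr.
  apply: le_trans (ler_wpM2l (expR_ge0 _) (inner f)) _.
  rewrite mulrCA ler_wpM2l // -expRD -big_split /= ler_expR.
  by apply: ler_sum => p _; lra.
rewrite -mulr_sumr ler_wpM2l //.
under eq_bigr do rewrite expR_sum.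
rewrite -(bigA_distr_bigA (fun p (j : Z) => expR (1 - signed_nat R j ^+ 2 / 2))).
have -> : 4 * #|C|%:R ^+ 2 = #|{: C * C}|%:R * 4 :> R.
  by rewrite card_prod natrM; ring.
rewrite expRM_natl -prodr_const; apply: ler_prod => p _.
by rewrite sumr_ge0 ?sum_expR_signed_nat // => j _; rewrite expR_ge0.
Qed.

End SignMatrices.

(** With [d = 576 m r], the threshold [b] corresponds to the exponent [6 r^2] against the moment
    exponent [4 r^2]. The failure probability is thus at most [expR (- 2 r^2)], hence at most
    [expR (- 2 m)]. On the diagonal, the relative error is at most [2 r / d = 1 / (288 m)]. *)
Lemma overlap_family_exists (R : realType) (m r : nat) :
  (0 < m)%N -> (m <= r ^ 2 <= 4 * m)%N ->
  exists f : {ffun 'I_m -> bool} -> {ffun 'I_(576 * m * r) * 'I_r -> bool},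
    forall k k',
    `|overlap R (f k) (f k') / (r%:R * (576 * m * r)%:R ^+ 2) - (k == k')%:R|
      <= 1 / (3 * m%:R).
Proof.
move=> m0 /andP[mr rm].
have r0 : (0 < r)%N by case: r mr {rm} => //; rewrite leqNgt m0.
have d0 : (0 < 576 * m * r)%N by rewrite !muln_gt0 m0 r0.
have dE : (576 * m * r)%:R = 576 * m%:R * r%:R :> R by rewrite !natrM.
have mR : 1 <= m%:R :> R by rewrite ler1n.
have rR : 1 <= r%:R :> R by rewrite ler1n.
have mrR : m%:R <= r%:R ^+ 2 :> R by rewrite -natrX ler_nat.
have rmR : r%:R ^+ 2 <= 4 * m%:R :> R by rewrite -natrX -natrM ler_nat.
set d := (576 * m * r)%N in d0 dE *.
pose T : finType := {ffun 'I_d * 'I_r -> bool}.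
have T0 : 0 < #|T|%:R :> R by rewrite ltr0n card_ffun expn_gt0 card_bool.
pose good : pred T := fun V => defect R V <= 2 * #|'I_r|%:R ^+ 2 * #|'I_d|%:R.
pose b : R := r%:R * d%:R ^+ 2 / (3 * m%:R).
pose bad : rel T := fun V W => b < overlap R V W.
have small V : good V -> defect R V <= 2 * r%:R ^+ 2 * d%:R.
  by rewrite /good !card_ord.
have sz : 2 * r%:R ^+ 2 <= d%:R :> R by rewrite dE; nra.
have m3 : 0 < 3 * m%:R :> R by lra.
have n0 : 0 < r%:R * d%:R ^+ 2 :> R by rewrite mulr_gt0 ?exprn_gt0 ?ltr0n.
have [|V gV|||f [gf bf]] := @greedy_random R T {ffun 'I_m -> bool} good bad
   (#|T|%:R * expR (- (2 * m%:R))).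
- by move=> V W; rewrite /bad overlapC.
- have h : defect R V <= #|'I_d|%:R ^+ 2.
    apply: le_trans (small V gV) _.
    by rewrite card_ord expr2 ler_wpM2r.
  have := sum_expR_overlap h; rewrite !card_ord => /(_ d0) hs.
  apply: le_trans (le_trans (_ : _ <= _) (markov_expR (b / (32 * d%:R)) hs)) _.
    rewrite ler_nat; apply: subset_leq_card; apply/fintype.subsetP => W.
    rewrite !inE /= -[W \in _]/(bad V W) /bad => bW.
    by rewrite ltr_pM2r // invr_gt0 mulr_gt0 // ltr0n.
  rewrite ler_pM2l // ler_expR.
  have -> : b / (32 * d%:R) = 6 * r%:R ^+ 2.
    by rewrite /b dE; field; lra.
  by lra.
- by rewrite mulr_ge0 ?expR_ge0.
(* At least half of all sign matrices have a small defect, which outnumbers everything the chosen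
   ones can exclude. *)
- have -> : #|{ffun 'I_m -> bool}| = (2 ^ m)%N by rewrite card_ffun card_bool card_ord.
  apply: lt_le_trans (_ : _ < #|T|%:R / 2) _; last first.
    by apply: card_small_defect; rewrite card_ord.
  rewrite -mulrA ltr_pM2l //.
  by have := pow2_expRN_lt R m0; lra.
exists f => k k'; case: eqP => [<-|/eqP/bf].
  have := small _ (gf k); have := defect_ge0 R (f k).
  rewrite overlap_diag !card_ord => p q.
  rewrite mulrDl divff ?lt0r_neq0 // addrAC subrr add0r ger0_norm; last first.
    by rewrite divr_ge0 // ltW.
  rewrite ler_pdivrMr //; apply: le_trans q _.
  have -> : 1 / (3 * m%:R) * (r%:R * d%:R ^+ 2) = 192 * (r%:R ^+ 2 * d%:R) :> R.
    by rewrite dE; field; lra.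
  by have : 0 <= r%:R ^+ 2 * d%:R :> R; [rewrite mulr_ge0 ?sqr_ge0 | lra].
rewrite /bad -leNgt => h; rewrite subr0 ger0_norm.
  by rewrite ler_pdivrMr // mul1r mulrC.
by rewrite divr_ge0 ?overlap_ge0 ?(ltW n0).
Qed.

Lemma sqrt_between (m : nat) : exists r, (m <= r ^ 2 <= 4 * m)%N.
Proof.
elim: m => [|m [r /andP[h1 h2]]]; first by exists 0%N.
have [h|h] := ltnP m (r ^ 2); first by exists r; rewrite h; lia.
by exists r.+1; move: h1 h2 h; rewrite -!mulnn; nia.
Qed.

(** * Upper bounds on approximate ranks *)

Lemma min_nat_le (R : realType) (S : set nat) (r : nat) (x : R) :
  S r -> r%:R <= x -> (min_nat R S <= x%:E)%E.
Proof.
move=> Sr rx; apply: ge_ereal_inf; exists (r%:R)%:E; last by rewrite lee_fin.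
by exists r.
Qed.

(** The definition asks for rank exactly 1, so the zero summands are discarded before counting. *)
Lemma nonneg_rank_approx_le (R : realType) (p q : nat) (eps : R)
    (M : 'M[R]_(p, q)) (I : finType) (N : I -> 'M[R]_(p, q)) (x : R) :
  (forall i, nonneg_mx (N i)) -> (forall i, (\rank (N i) <= 1)%N) ->
  approx_mx eps M (\sum_i N i) -> #|I|%:R <= x ->
  (nonneg_rank_approx eps M <= x%:E)%E.
Proof.
move=> N0 N1 hN hx; pose A := [pred i | N i != 0].
apply: (@min_nat_le _ _ #|A|); last first.
  by apply: le_trans hx; rewrite ler_nat max_card.
exists (fun k => N (enum_val k)); split.
  move=> k; split; first exact: N0.
  apply/eqP; rewrite eqn_leq N1 lt0n mxrank_eq0.
  by have := enum_valP k; rewrite inE.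
suff -> : \sum_(k < #|A|) N (enum_val k) = \sum_i N i by [].
rewrite -(big_enum_val (A := A)) [RHS](bigID A) /= [X in _ = _ + X]big1 ?addr0 //.
by move=> i; rewrite negbK => /eqP.
Qed.

Lemma conjC_real (R : realType) (x : R) : Num.conj (x%:C)%C = (x%:C)%C :> R[i].
Proof. exact: conjc_real. Qed.

Lemma psd_mx_gram (R : realType) (d e : nat) (F : 'M[R]_(d, e)) :
  psd_mx (map_mx (real_complex R) (F *m F^T)).
Proof.
split.
  apply/is_hermitianmxP; rewrite expr0 scale1r.
  apply/matrixP => i j; rewrite !mxE conjC_real; congr (_%:C)%C.
  by apply: eq_bigr => k _; rewrite !mxE mulrC.
have -> : map_mx (real_complex R) (F *m F^T)
    = map_mx (real_complex R) F *m (map_mx (real_complex R) F)^T.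
  by rewrite map_mxM map_trmx.
move=> v; rewrite mulmxA -mulmxA.
set w := (map_mx _ F)^T *m v.
have -> : (v ^t* )%sesqui *m map_mx (real_complex R) F = (w ^t* )%sesqui.
  rewrite /w trmx_mul trmxK map_mxM; congr (_ *m _).
  by apply/matrixP => i j; rewrite !mxE; symmetry; apply: conjC_real.
rewrite mxE; apply: sumr_ge0 => k _.
by rewrite !mxE mulrC mul_conjC_ge0.
Qed.

(** By cyclicity, the trace of [F F^T G G^T] is the squared Frobenius norm of [F^T G]. The psd
    matrices have size [#|I|], however many columns [F] and [G] have. *)
Lemma psd_rank_le (R : realType) (p q : nat) (M : 'M[R]_(p, q))
    (I J : finType) (F : 'I_p -> I -> J -> R) (G : 'I_q -> I -> J -> R) (x : R) :
  (forall i j, M i j = \sum_k \sum_l (\sum_a F i a k * G j a l) ^+ 2) ->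
  #|I|%:R <= x -> (psd_rank M <= x%:E)%E.
Proof.
move=> hM hx; apply: (@min_nat_le _ _ #|I|) => //.
pose mx (H : I -> J -> R) : 'M[R]_(#|I|, #|J|) :=
  \matrix_(a, k) H (enum_val a) (enum_val k).
exists (fun i => map_mx (real_complex R) (mx (F i) *m (mx (F i))^T)).
exists (fun j => map_mx (real_complex R) (mx (G j) *m (mx (G j))^T)).
split=> [i|j|i j]; try exact: psd_mx_gram.
rewrite -map_mxM trace_map_mx; congr (_%:C)%C.
rewrite -mulmxA mxtrace_mulC -!mulmxA.
pose A := (mx (F i))^T *m mx (G j).
rewrite [X in \tr X](_ : _ = A *m A^T); last first.
  by rewrite trmx_mul trmxK !mulmxA.
rewrite hM [LHS](reindex _ (onW_bij _ (enum_val_bij J))) /mxtrace /=.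
apply: eq_bigr => k _.
rewrite mxE [LHS](reindex _ (onW_bij _ (enum_val_bij J))) /=.
apply: eq_bigr => l _.
rewrite expr2 !mxE (reindex _ (onW_bij _ (enum_val_bij I))) /=.
by congr (_ * _); apply: eq_bigr => a _; rewrite !mxE.
Qed.

(** * The sink function *)

Definition row_key (m : nat) (x : 'C(m, 2).-tuple bool) (v : 'I_m) :
    {ffun 'I_m -> bool} :=
  [ffun u : 'I_m => (u != v) && Defs.arc x u v].

(** The values that the arcs of [x] must take for [v] to be a sink of the XOR. The orientation
    convention negates [arc y u v] exactly when [u < v]; the entry at [v] is false in both keys. *)
Definition col_key (m : nat) (y : 'C(m, 2).-tuple bool) (v : 'I_m) :
    {ffun 'I_m -> bool} :=
  [ffun u : 'I_m => (u != v) && ((u < v)%N (+) Defs.arc y u v)].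

Lemma arc_xor (m : nat) (x y : 'C(m, 2).-tuple bool) (u v : 'I_m) : u != v ->
  Defs.arc [tuple tnth x k (+) tnth y k | k < 'C(m, 2)] u v
  = (Defs.arc x u v == ((u < v)%N (+) Defs.arc y u v)).
Proof.
have nthE (i j : nat) : (i < j)%N -> (j < m)%N ->
    nth false [tuple tnth x k (+) tnth y k | k < 'C(m, 2)] (edge_index i j)
    = nth false x (edge_index i j) (+) nth false y (edge_index i j).
  move=> ij jm; have lt := edge_index_lt ij jm.
  by rewrite -(tnth_nth _ _ (Ordinal lt)) tnth_mktuple !(tnth_nth false).
rewrite -val_eqE neq_ltn /Defs.arc => /orP[uv|vu].
  by rewrite uv nthE //; do 2!case: nth.
by rewrite ltnNge (ltnW vu) /= nthE //; do 2!case: nth.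
Qed.

Lemma is_sink_xor (m : nat) (x y : 'C(m, 2).-tuple bool) (v : 'I_m) :
  is_sink [tuple tnth x k (+) tnth y k | k < 'C(m, 2)] v
  = (row_key x v == col_key y v).
Proof.
apply/forallP/eqP => [h|/ffunP h u].
  apply/ffunP => u; rewrite !ffunE; case: eqVneq => //= uv.
  by have := h u; rewrite uv arc_xor //= => /eqP.
apply/implyP => uv; rewrite arc_xor //; apply/eqP.
by have := h u; rewrite !ffunE uv.
Qed.

(** The edge between two distinct sinks would have to point to both ends. *)
Lemma is_sink_unique (m : nat) (z : 'C(m, 2).-tuple bool) (u v : 'I_m) :
  is_sink z u -> is_sink z v -> u = v.
Proof.
move=> /forallP hu /forallP hv; apply/eqP; apply: contraT => uv.
have := hv u; have := hu v; rewrite uv eq_sym uv /= /Defs.arc.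
by case: (ltngtP u v) => [_|_|/val_inj e]; [case: nth| case: nth|rewrite e eqxx in uv].
Qed.

Lemma SINK_sum (R : pzSemiRingType) (m : nat) (z : 'C(m, 2).-tuple bool) :
  (SINK z)%:R = \sum_v (is_sink z v)%:R :> R.
Proof.
rewrite /SINK; case: existsP => [[v hv]|h].
  rewrite (bigD1 v) //= hv big1 ?addr0 // => u uv.
  case hu: (is_sink z u) => //.
  by move: uv; rewrite (is_sink_unique hu hv) eqxx.
rewrite big1 // => v _; case hv: (is_sink z v) => //.
by case: h; exists v.
Qed.

(** * Rank bounds for the sink matrix *)

Lemma comm_matrix_SINK_xor (R : realType) (m : nat) i j :
  comm_matrix R (comp_XOR (@SINK m)) i j
  = \sum_v (row_key (enum_val i) v == col_key (enum_val j) v)%:R.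
Proof.
by rewrite mxE /comp_XOR SINK_sum; apply: eq_bigr => v _; rewrite is_sink_xor.
Qed.

Lemma approx_SINK_xor (R : realType) (m : nat)
    (E : {ffun 'I_m -> bool} -> {ffun 'I_m -> bool} -> R) (M' : 'M[R]_(_, _)) :
  (0 < m)%N -> (forall k k', `|E k k' - (k == k')%:R| <= 1 / (3 * m%:R)) ->
  (forall i j, M' i j
     = \sum_v E (row_key (enum_val i) v) (col_key (enum_val j) v)) ->
  approx_mx (1 / 3) (comm_matrix R (comp_XOR (@SINK m))) M'.
Proof.
move=> m0 hE hM i j; rewrite hM comm_matrix_SINK_xor -sumrB.
apply: le_trans (ler_norm_sum _ _ _) _.
apply: le_trans (ler_sum _ (fun v _ => hE _ _)) _.
rewrite sumr_const card_ord -mulr_natl le_eqVlt; apply/orP; left; apply/eqP.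
by field; rewrite lt0r_neq0 ?ltr0n.
Qed.

Lemma nonneg_rank_SINK_xor (R : realType) (m : nat) : (0 < m)%N ->
  (nonneg_rank_approx (1 / 3) (comm_matrix R (comp_XOR (@SINK m)))
     <= (216 * m%:R ^+ 4)%:E)%E.
Proof.
move=> m0; have mR : 0 < m%:R :> R by rewrite ltr0n.
have [c hc] := code_exists R m0.
set n := (12 * m ^ 2)%N in c hc.
have nR : n%:R = 12 * m%:R ^+ 2 :> R by rewrite natrM natrX.
have n0 : 0 < n%:R :> R by rewrite nR mulr_gt0 ?exprn_gt0.
pose X (i : 'I_#|{: 'C(m, 2).-tuple bool}|) v t := c (row_key (enum_val i) v) t.
pose Y (i : 'I_#|{: 'C(m, 2).-tuple bool}|) v t := c (col_key (enum_val i) v) t.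
(* One scaled rectangle per vertex, position and letter: both codewords carry that letter there.
   This gives [m * 12 m^2 * 18 m = 216 m^4] rectangles. *)
pose N (p : 'I_m * 'I_n * 'I_(18 * m)) : 'M[R]_(_, _) :=
  (\col_i (n%:R^-1 * (X i p.1.1 p.1.2 == p.2)%:R)) *m
  (\row_j (Y j p.1.1 p.1.2 == p.2)%:R).
have NE p i j : N p i j
    = n%:R^-1 * (X i p.1.1 p.1.2 == p.2)%:R * (Y j p.1.1 p.1.2 == p.2)%:R.
  by rewrite mxE big_ord1 !mxE.
apply: (@nonneg_rank_approx_le _ _ _ _ _ _ N).
- by move=> p i j; rewrite NE !mulr_ge0 ?invr_ge0 ?ler0n.
- by move=> p; apply: leq_trans (mxrankM_maxl _ _) (rank_leq_col _).
- apply: (@approx_SINK_xor _ _ (fun k k' => (agreement (c k) (c k'))%:R / n%:R)) => //.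
    move=> k k'; case: eqP => [<-|/eqP/hc h].
      rewrite /agreement (eq_card (_ : _ =i 'I_n)) => [|t]; last by rewrite !inE eqxx.
      by rewrite card_ord divff ?lt0r_neq0 // subrr normr0 divr_ge0 // mulr_ge0.
    rewrite subr0 ger0_norm ?divr_ge0 // ler_pdivrMr //.
    have -> : 1 / (3 * m%:R) * n%:R = (4 * m)%:R :> R.
      by rewrite natrM nR; field; rewrite lt0r_neq0.
    by rewrite ler_nat.
  move=> i j; rewrite summxE -(pair_bigA _ (fun q a => N (q, a) i j)) /=.
  rewrite -(pair_bigA _ (fun v t => \sum_a N (v, t, a) i j)) /=.
  apply: eq_bigr => v _; rewrite natr_agreement mulr_suml.
  apply: eq_bigr => t _; rewrite (bigD1 (X i v t)) //= NE eqxx mulr1.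
  rewrite big1 ?addr0 => [|a /negPf]; last first.
    by rewrite NE /= eq_sym => ->; rewrite mulr0 mul0r.
  by rewrite /X /Y /= eq_sym; case: eqP; rewrite ?mul1r ?mulr1 ?mulr0 ?mul0r.
rewrite !card_prod !card_ord !natrM le_eqVlt; apply/orP; left; apply/eqP.
by ring.
Qed.

Lemma psd_rank_SINK_xor (R : realType) (m : nat) : (0 < m)%N ->
  (psd_rank_approx (1 / 3) (comm_matrix R (comp_XOR (@SINK m)))
     <= (1152 * m%:R `^ (5 / 2))%:E)%E.
Proof.
move=> m0; have mR : 0 < m%:R :> R by rewrite ltr0n.
have [r hr] := sqrt_between m.
have [f hf] := overlap_family_exists R m0 hr.
set d := (576 * m * r)%N in f hf.
pose g : R := r%:R * d%:R ^+ 2.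
have g0 : 0 <= g by rewrite mulr_ge0 ?sqr_ge0.
pose E k k' : R := overlap R (f k) (f k') / g.
pose M' : 'M[R]_(#|{: 'C(m, 2).-tuple bool}|, #|{: 'C(m, 2).-tuple bool}|) :=
  \matrix_(i, j) \sum_v E (row_key (enum_val i) v) (col_key (enum_val j) v).
apply: ge_ereal_inf; exists (psd_rank M').
  exists M' => //; split.
    move=> i j; rewrite mxE; apply: sumr_ge0 => v _.
    by rewrite divr_ge0 ?overlap_ge0.
  by apply: (@approx_SINK_xor _ _ E) => // i j; rewrite mxE.
(* A block-diagonal matrix whose block at vertex [v] is the sign matrix of the key at [v]. The whole
   normalization [1 / g] of the squares is put on the column side, as a factor [Num.sqrt g^-1]. *)
pose F (key : 'C(m, 2).-tuple bool -> 'I_m -> {ffun 'I_m -> bool})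
    (i : 'I_#|{: 'C(m, 2).-tuple bool}|) (a : 'I_m * 'I_d) (k : 'I_m * 'I_r) : R :=
  (a.1 == k.1)%:R * entry R (f (key (enum_val i) a.1)) a.2 k.2.
apply: (@psd_rank_le _ _ _ _ _ _ (F (@row_key m))
  (fun j a k => Num.sqrt g^-1 * F (@col_key m) j a k)).
  move=> i j; rewrite mxE.
  rewrite -(pair_bigA _ (fun v k => \sum_l (\sum_a F (@row_key m) i a (v, k)
    * (Num.sqrt g^-1 * F (@col_key m) j a l)) ^+ 2)) /=.
  apply: eq_bigr => v _; rewrite /E /overlap mulr_suml; apply: eq_bigr => k _.
  rewrite -(pair_bigA _ (fun w l => (\sum_a F (@row_key m) i a (v, k)
    * (Num.sqrt g^-1 * F (@col_key m) j a (w, l))) ^+ 2)) /=.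
  (* Blocks of different vertices have disjoint supports, so only [w = v] contributes. *)
  have inner w l : \sum_a F (@row_key m) i a (v, k)
      * (Num.sqrt g^-1 * F (@col_key m) j a (w, l))
    = (v == w)%:R * (Num.sqrt g^-1 * col_dot R (f (row_key (enum_val i) v)) k
                                      (f (col_key (enum_val j) v)) l).
    rewrite -(pair_bigA _ (fun u a => F (@row_key m) i (u, a) (v, k)
      * (Num.sqrt g^-1 * F (@col_key m) j (u, a) (w, l)))) /=.
    rewrite (bigD1 v) //= [X in _ + X]big1 ?addr0 => [|u uv]; last first.
      by rewrite big1 // => a _; rewrite /F /= (negPf uv) !mul0r.
    rewrite /col_dot !mulr_sumr; apply: eq_bigr => a _.
    by rewrite /F /= eqxx mul1r; ring.
  rewrite (bigD1 v) //= [X in _ + X]big1 ?addr0 => [|w wv]; last first.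
    by rewrite big1 // => l _; rewrite inner eq_sym (negPf wv) mul0r expr0n.
  rewrite mulr_suml; apply: eq_bigr => l _.
  by rewrite inner eqxx mul1r exprMn sqr_sqrtr ?invr_ge0 // mulrC.
rewrite card_prod !card_ord /d.
have -> : (5 / 2 : R) = 2 + 2^-1 by field.
rewrite powRD ?(lt0r_neq0 mR) ?implybT // powR12_sqrt ?(ltW mR) //.
rewrite powR_mulrn ?(ltW mR) // !natrM.
(* The dimension is [m * d = 576 m^2 r], and [r <= 2 sqrt m] turns it into [1152 m^2.5]. *)
have h : r%:R <= 2 * Num.sqrt m%:R :> R.
  rewrite -(ler_pXn2r (n := 2)) ?nnegrE ?mulr_ge0 ?sqrtr_ge0 //.
  have : r%:R ^+ 2 <= 4 * m%:R :> R.
    by rewrite -natrX -natrM ler_nat; case/andP: hr.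
  by rewrite exprMn (sqr_sqrtr (ltW mR)); lra.
have -> : m%:R * (576 * m%:R * r%:R) = 576 * m%:R ^+ 2 * r%:R :> R by ring.
have -> : 1152 * (m%:R ^+ 2 * Num.sqrt m%:R)
   = 576 * m%:R ^+ 2 * (2 * Num.sqrt m%:R) :> R by ring.
by rewrite ler_wpM2l // mulr_ge0 ?sqr_ge0.
Qed.

Theorem claim6p2 (R : realType) :
  exists K : R, forall m : nat, (0 < m)%N ->
    (nonneg_rank_approx (1 / 3) (comm_matrix R (comp_XOR (@SINK m)))
       <= (K * m%:R ^+ 4)%:E)%E /\
    (psd_rank_approx (1 / 3) (comm_matrix R (comp_XOR (@SINK m)))
       <= (K * m%:R `^ (5 / 2))%:E)%E.
Proof.
exists 1152 => m m0; split; last exact: psd_rank_SINK_xor.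
apply: le_trans (nonneg_rank_SINK_xor R m0) _.
by rewrite lee_fin ler_wpM2r ?exprn_ge0 // ler_nat.
Qed.
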